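(* The universal proshift is not topologically transitive.
   Context: Deterministic systems. A deterministic system is a pair $(X,T)$ with $X$ a zero-dimensional, second-countable, compact Hausdorff space and $T:X\to X$ continuous. A factor $f:(Y,S)\to(X,T)$ is a continuous surjection with $f\circ S=T\circ f$. An embedding-factor pair (ef-pair) $(e,f):(X,T)\to(Y,S)$ consists of a factor $f:(Y,S)\to(X,T)$ together with the multifunction $e:x\mapsto f^{-1}(x)$ (the embedding uniquely determined by $f$); composition is $(e',f')\circ(e,f)=(e'\circ e,f\circ f')$. $\mathsf{detSys}^{\mathsf{ef}}$ is the category of nonempty deterministic systems with ef-pairs as morphisms. Shifts. For a finite alphabet $A$, $A^\omega$ has the product of discrete topologies and $\sigma(x)_n=x_{n+1}$. A shift is a closed subset $X\subseteq A^\omega$ with $\sigma[X]\subseteq X$, regarded as the system $(X,\sigma)$. It is of finite type if there is a finite set $F$ of words over $A$ such that $X$ is the set of sequences in $A^\omega$ containing no word of $F$. $\mathsf{SFT}$ is the class of (nonempty) shifts of finite type. $\mathsf{DS}^{\mathsf{ef}}(\mathsf{SFT})$ is the full subcategory of $\mathsf{detSys}^{\mathsf{ef}}$ consisting of the colimits in $\mathsf{detSys}^{\mathsf{ef}}$ of $\omega$-chains $X_0\to X_1\to\cdots$ of shifts in $\mathsf{SFT}$. The universal proshift is the up to isomorphism unique system $(U,T)$ in $\mathsf{DS}^{\mathsf{ef}}(\mathsf{SFT})$ such that every system in $\mathsf{DS}^{\mathsf{ef}}(\mathsf{SFT})$ admits a morphism to $(U,T)$ (universality) and for every $A\in\mathsf{SFT}$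 and morphisms $g,g':A\to(U,T)$ there is an automorphism $h$ of $(U,T)$ with $h\circ g'=g$ (homogeneity). (The same system is also the unique universal and homogeneous one when shifts of finite type are replaced by sofic shifts.) A system $(X,T)$ with $T:X\to X$ continuous is topologically transitive if for all nonempty open $V,W\subseteq X$ there is an integer $n\geq0$ with $T^n[V]\cap W\neq\emptyset$. *)

(* Defs.v *)
From HB Require Import structures.
From mathcomp Require Import all_boot all_classical topology.

Set Implicit Arguments.
Unset Strict Implicit.
Unset Printing Implicit Defensive.

Local Open Scope classical_set_scope.

(* Zero-dimensionality. The library's [zero_dimensional] only asks that clopen
   sets separate points; for compact Hausdorff spaces the two are equivalent. *)
Definition clopen_basis (X : topologicalType) :=
  exists2 B : set (set X), B `<=` clopen & basis B.

Record detSys := DetSys {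
  space :> topologicalType;
  dyn : space -> space;
  space_clopen_basis : clopen_basis space;
  space_second_countable : @second_countable space;
  space_compact : compact [set: space];
  space_hausdorff : hausdorff_space space;
  dyn_continuous : continuous dyn
}.
Arguments dyn : clear implicits.

Definition topologically_transitive (X : detSys) :=
  forall V W : set X, open V -> V !=set0 -> open W -> W !=set0 ->
    exists n : nat, (iter n (dyn X) @` V) `&` W !=set0.

Record detSysEf := DetSysEf {
  sys :> detSys;
  sys_nonempty : [set: sys] !=set0
}.

Record factor (Y X : detSys) := Factor {
  factor_fun :> Y -> X;
  factor_continuous : continuous factor_fun;
  factor_surj : range factor_fun = setT;
  factor_equivariant : factor_fun \o dyn Y = dyn X \o factor_fun
}.

Program Definition factor_id (X : detSys) : factor X X :=
  @Factor X X idfun _ _ _.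
Next Obligation. by move=> X x; exact: cvg_id. Qed.
Next Obligation. by move=> X; rewrite image_id. Qed.
Next Obligation. by []. Qed.

Program Definition factor_comp (Z Y X : detSys)
    (f : factor Y X) (g : factor Z Y) : factor Z X :=
  @Factor Z X (f \o g) _ _ _.
Next Obligation.
move=> Z Y X f g z; apply: continuous_comp; exact: factor_continuous.
Qed.
Next Obligation.
move=> Z Y X f g; apply/seteqP; split=> // x _.
have [y _ <-] : range f x by rewrite factor_surj.
have [z _ <-] : range g y by rewrite factor_surj.
by exists z.
Qed.
Next Obligation.
move=> Z Y X f g; apply/funext => z /=.
have /(congr1 (@^~ z)) /= -> := factor_equivariant g.
by have /(congr1 (@^~ (g z))) /= -> := factor_equivariant f.
Qed.

(* A morphism X -> Y: the factor goes backwards, the multifunction forwards. *)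
Record efPair (X Y : detSysEf) := EfPair {
  emb : X -> set Y;
  fac : factor Y X;
  embE : emb = fun x => fac @^-1` [set x]
}.

Program Definition ef_id (X : detSysEf) : efPair X X :=
  @EfPair X X (fun x => [set x]) (factor_id X) _.
Next Obligation. by []. Qed.

Program Definition ef_comp (X Y Z : detSysEf)
    (h : efPair Y Z) (g : efPair X Y) : efPair X Z :=
  @EfPair X Z (fun x => \bigcup_(y in emb g x) emb h y)
    (factor_comp (fac g) (fac h)) _.
Next Obligation.
move=> X Y Z h g; apply/funext => x; rewrite !embE.
by apply/seteqP; split=> [z [y /= <- <-]//|z /= <-]; exists (fac h z).
Qed.

Definition ef_automorphism (X : detSysEf) (h : efPair X X) :=
  exists k : efPair X X, ef_comp k h = ef_id X /\ ef_comp h k = ef_id X.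

Section Colimits.
Variables (X : nat -> detSysEf) (g : forall n, efPair (X n) (X n.+1)).

Definition is_cocone (C : detSysEf) (c : forall n, efPair (X n) C) :=
  forall n, ef_comp (c n.+1) (g n) = c n.

Definition is_colimit (C : detSysEf) (c : forall n, efPair (X n) C) :=
  is_cocone c /\
  forall (D : detSysEf) (d : forall n, efPair (X n) D), is_cocone d ->
    exists! h : efPair C D, forall n, ef_comp h (c n) = d n.

End Colimits.

Definition sequences (A : finType) := {ptws nat -> discrete_topology A}.

Definition shift_map (A : finType) (x : sequences A) : sequences A :=
  fun n => x n.+1.

Record shift := Shift {
  alphabet : finType;
  shift_set :> set (sequences alphabet);
  shift_closed : closed shift_set;
  shift_stable : @shift_map alphabet @` shift_set `<=` shift_set
}.
Arguments shift_set : clear implicits.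

Definition contains_word (A : finType) (x : sequences A) (w : seq A) :=
  exists n : nat, [seq x i | i <- iota n (size w)] = w.

Definition of_finite_type (X : shift) :=
  exists F : seq (seq (alphabet X)),
    X = [set x | forall w, w \in F -> ~ contains_word x w] :> set _.

Section ShiftSystem.

Definition cylinder (A : finType) (w : seq A) : set (sequences A) :=
  [set x | [seq x i | i <- iota 0 (size w)] = w].

Lemma cylinderP (A : finType) (w : seq A) (x y : sequences A) :
  cylinder w x -> cylinder w y <-> forall i, (i < size w)%N -> y i = x i.
Proof.
rewrite /cylinder /= => wx; split=> [wy i iw|yx].
  have := congr1 (fun s => nth (x i) s i) (etrans wy (esym wx)).
  by rewrite !(nth_map 0%N) ?size_iota// nth_iota.
rewrite -[RHS]wx; apply/eq_in_map => i.
by rewrite mem_iota/= => /yx.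
Qed.

Lemma proj_continuous_sequences (A : finType) (i : nat) :
  continuous (fun x : sequences A => (x i : discrete_topology A)).
Proof. exact: (@proj_continuous nat (fun=> discrete_topology A)). Qed.

Lemma clopen_coord (A : finType) (i : nat) (a : A) :
  clopen [set x : sequences A | x i = a].
Proof.
have := @preimage_clopen (sequences A) (discrete_topology A)
  (fun x => x i) [set a].
apply; last exact: proj_continuous_sequences.
by split; [exact: discrete_open|exact: discrete_closed].
Qed.

Lemma clopen_cylinder (A : finType) (w : seq A) : clopen (cylinder w).
Proof.
have [->|/set0P[x wx]] := eqVneq (cylinder w) set0; first exact: clopen0.
rewrite (_ : cylinder w =
    \bigcap_(i in `I_(size w)) [set y : sequences A | y i = x i]); last first.
  by apply/seteqP; split => y; [move/(cylinderP _ wx)|move=> /= yx; apply/(cylinderP _ wx)].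
split.
  rewrite bigcap_mkord; apply: big_ind => [|U V|i _]; first exact: openT.
    exact: openI.
  by case: (clopen_coord i (x i)).
by apply: closed_bigI => i _; case: (clopen_coord i (x i)).
Qed.

Lemma basis_cylinder (A : finType) : basis (range (@cylinder A)).
Proof.
split=> [_ [w _ <-]|x]; first by case: (clopen_cylinder w).
pose pre n := [seq x i | i <- iota 0 n].
have preE n : cylinder (pre n) x.
  by rewrite /cylinder /pre /= size_map size_iota.
have preP n y : (forall i, (i < n)%N -> y i = x i) <-> cylinder (pre n) y.
  by rewrite (cylinderP _ (preE n)) size_map size_iota.
have G : Filter (filter_from setT (fun n => cylinder (pre n))).
  apply: filter_from_filter; first by exists 0%N.
  move=> m n _ _; exists (maxn m n) => // y /preP yx.
  by split; apply/preP => i im; apply: yx; rewrite leq_max im ?orbT.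
suff Gx : filter_from setT (fun n => cylinder (pre n)) --> x.
  by move=> U /Gx [n _ nU]; exists (cylinder (pre n)); [split; [exists (pre n)|]|].
apply/cvg_sup => i U [_ [[V oV <-] Vx VU]].
exists i.+1 => // y /preP /(_ i (ltnSn i)) yx; apply: VU.
by rewrite /= yx.
Qed.

Lemma sequences_compact (A : finType) : compact [set: sequences A].
Proof.
have := @tychonoff nat (fun=> discrete_topology A) (fun=> setT).
rewrite (_ : [set f | _] = setT); last by apply/seteqP; split.
apply=> _; apply: finite_compact; exact: (@finite_finset A setT).
Qed.

Lemma sequences_hausdorff (A : finType) : hausdorff_space (sequences A).
Proof.
apply: (@hausdorff_product nat (fun=> discrete_topology A)) => _.
exact: discrete_hausdorff.
Qed.

Lemma shift_map_continuous (A : finType) : continuous (@shift_map A).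
Proof.
move=> x.
have F : Filter (@shift_map A @ x) by apply: fmap_filter; exact: nbhs_filter.
apply/cvg_sup => i U [_ [[V oV <-] Vx VU]]; apply: (filterS VU).
apply: (@proj_continuous_sequences A i.+1 x).
exact: open_nbhs_nbhs.
Qed.

Variable X : shift.

Let dom := set_type (shift_set X).

Lemma shift_mem (x : dom) : shift_map (\val x) \in shift_set X.
Proof. by apply/mem_set/shift_stable; exists (\val x) => //; exact: set_valP. Qed.

Definition shift_dyn (x : dom) : dom := SigSub (shift_mem x).

Let B : set (set dom) := range (fun w => set_val @^-1` cylinder w).

Let basisB : basis B.
Proof.
split=> [_ [w _ <-]|x U].
  by exists (cylinder w) => //; case: (clopen_cylinder w).
move=> [_ [[V oV <-] Vx VU]].
have [_ nV] := basis_cylinder (alphabet X).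
have [_ [[w _ <-] wx] wV] := nV _ _ (open_nbhs_nbhs (conj oV Vx)).
exists (set_val @^-1` cylinder w); first by split => //; exists w.
by move=> y /wV /VU.
Qed.

Lemma shift_clopen_basis : clopen_basis dom.
Proof.
exists B => // _ [w _ <-]; apply: preimage_clopen; first exact: clopen_cylinder.
exact: initial_continuous.
Qed.

Lemma shift_second_countable : @second_countable dom.
Proof. by exists B => //; apply: card_le_trans (card_image_le _ _) (countableP _). Qed.

Lemma shift_compact : compact [set: dom].
Proof.
move=> F PF FT.
have cX : compact (shift_set X).
  by apply: (subclosed_compact (@shift_closed X) (@sequences_compact _)).
have FX : (set_val @ F) (shift_set X).
  by apply: (@filterS _ F _ setT) => // y _; exact: set_valP.
have [p [Xp clp]] := cX _ (fmap_proper_filter _ PF) FX.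
exists (SigSub (mem_set Xp)); split=> // V U FV [_ [[W oW <-] Wp WU]].
have FV' : (set_val @ F) (set_val @` V).
  by apply: (@filterS _ F _ V) => // y Vy; exists y.
have [_ [[y Vy <-] Wy]] := clp _ _ FV' (open_nbhs_nbhs (conj oW Wp)).
by exists y; split => //; exact: WU.
Qed.

Lemma shift_hausdorff : hausdorff_space dom.
Proof.
move=> x y clxy; apply: val_inj; apply: sequences_hausdorff => V W Vx Wy.
have cv : continuous (set_val : dom -> _) by exact: initial_continuous.
by have [z [Vz Wz]] := clxy _ _ (cv x _ Vx) (cv y _ Wy); exists (set_val z).
Qed.

Lemma shift_dyn_continuous : continuous shift_dyn.
Proof.
apply: continuous_comp_initial => x.
apply: (@continuous_comp _ _ _ set_val (@shift_map _)).
  exact: initial_continuous.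
exact: shift_map_continuous.
Qed.

Definition shift_sys : detSys :=
  DetSys shift_clopen_basis shift_second_countable shift_compact
    shift_hausdorff shift_dyn_continuous.

End ShiftSystem.

Record sft := Sft {
  sft_shift :> shift;
  sft_finite_type : of_finite_type sft_shift;
  sft_nonempty : sft_shift !=set0
}.

Program Definition sft_sys (X : sft) : detSysEf :=
  @DetSysEf (shift_sys X) _.
Next Obligation.
by move=> X; have [x Xx] := sft_nonempty X; exists (SigSub (mem_set Xx)).
Qed.

Definition DS_SFT (C : detSysEf) :=
  exists (X : nat -> sft)
    (g : forall n, efPair (sft_sys (X n)) (sft_sys (X n.+1)))
    (c : forall n, efPair (sft_sys (X n)) C),
    @is_colimit (sft_sys \o X) g C c.

Definition universal_in_DS_SFT (U : detSysEf) :=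
  forall Y : detSysEf, DS_SFT Y -> inhabited (efPair Y U).

Definition SFT_homogeneous (U : detSysEf) :=
  forall (A : sft) (g g' : efPair (sft_sys A) U),
    exists h : efPair U U, ef_automorphism h /\ ef_comp h g' = g.

(* The universal proshift is only determined up to isomorphism, so it is given
   as a predicate on systems. *)
Definition universal_proshift (U : detSysEf) :=
  [/\ DS_SFT U, universal_in_DS_SFT U & SFT_homogeneous U].

(* Main.v *)
From mathcomp Require Import all_boot all_classical topology.
Require Import Defs.

(** By universality every nonempty shift of finite type is a factor of the
    universal proshift, since it is the colimit of its constant chain. Factors
    of transitive systems are transitive, but the two-point shift
    [{000..., 111...}], on which the dynamics is the identity, is of finite
    type and not transitive. *)

Set Implicit Arguments.
Unset Strict Implicit.
Unset Printing Implicit Defensive.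

Local Open Scope classical_set_scope.

Lemma factor_iter (Y X : detSys) (f : factor Y X) (n : nat) (y : Y) :
  f (iter n (dyn Y) y) = iter n (dyn X) (f y).
Proof.
elim: n => //= n <-.
exact: (congr1 (fun h => h (iter n (dyn Y) y)) (factor_equivariant f)).
Qed.

(** Pull both open sets back along [f]: continuity keeps them open and surjectivity keeps them
    nonempty. An orbit in [Y] joining the preimages is carried by equivariance to one in [X]. *)
Lemma factor_transitive (Y X : detSys) (f : factor Y X) :
  topologically_transitive Y -> topologically_transitive X.
Proof.
move=> trY V W oV [v Vv] oW [w Ww].
have preim_neq0 (S : set X) s : S s -> f @^-1` S !=set0.
  have [y _ <-] : range f s by rewrite factor_surj.
  by exists y.
have preim_open (S : set X) : open S -> open (f @^-1` S).
  by move=> oS; apply: open_comp => // y _; exact: factor_continuous.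
have [n [_ [[y Vy <-] Wy]]] := trY _ _ (preim_open _ oV) (preim_neq0 _ _ Vv)
  (preim_open _ oW) (preim_neq0 _ _ Ww).
exists n, (f (iter n (dyn Y) y)); split=> //.
by exists (f y) => //; rewrite factor_iter.
Qed.

Lemma factor_ext (Y X : detSys) (f g : factor Y X) : f =1 g -> f = g.
Proof.
case: f g => [f cf sf ef] [g cg sg eg] /= /funext fg.
by move: cf sf ef; rewrite fg => *; congr Factor; exact: Prop_irrelevance.
Qed.

(** The multifunction [emb] is determined by the factor through [embE]. *)
Lemma efPair_ext (X Y : detSysEf) (g h : efPair X Y) :
  fac g =1 fac h -> g = h.
Proof.
case: g h => [e f ef] [e' f' ef'] /= /factor_ext ff'; subst.
by congr EfPair; exact: Prop_irrelevance.
Qed.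

Lemma ef_comp_id (X Y : detSysEf) (g : efPair X Y) : ef_comp g (ef_id X) = g.
Proof. exact: efPair_ext. Qed.

Lemma constant_chain_colimit (X : detSysEf) :
  @is_colimit (fun=> X) (fun=> ef_id X) X (fun=> ef_id X).
Proof.
split=> [n|D d dcc]; first exact: ef_comp_id.
(* Along identities the cocone condition reads [d n.+1 = d n], so the leg at 0 serves as the
   mediating morphism. *)
have d0 n : d n = d 0%N by elim: n => // n <-; rewrite -(dcc n) ef_comp_id.
exists (d 0%N); split=> [n|h hd]; first by rewrite ef_comp_id d0.
by rewrite -(hd 0%N) ef_comp_id.
Qed.

Lemma DS_SFT_sft (A : sft) : DS_SFT (sft_sys A).
Proof.
exists (fun=> A), (fun=> ef_id _), (fun=> ef_id _).
exact: constant_chain_colimit.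
Qed.

Lemma iter_shift_dyn (X : shift) (n i : nat) (x : shift_sys X) :
  \val (iter n (@shift_dyn X) x) i = \val x (n + i)%N.
Proof. by elim: n i => //= n IH i; rewrite /shift_map IH addnS. Qed.

Definition constant_sequences : set (sequences bool) :=
  range (fun b : bool => (fun=> b) : sequences bool).

Lemma constant_sequences_closed : closed constant_sequences.
Proof.
apply: (compact_closed (@sequences_hausdorff bool)).
exact/finite_compact/finite_image/finite_finset.
Qed.

Lemma constant_sequences_stable :
  @shift_map bool @` constant_sequences `<=` constant_sequences.
Proof. by move=> _ [_ [b _ <-] <-]; exists b. Qed.

Definition constant_shift : shift :=
  Shift constant_sequences_closed constant_sequences_stable.

Lemma constant_shift_finite_type : of_finite_type constant_shift.
Proof.
(* Forbidding both words of two distinct letters forces neighbouring letters to agree; induction on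
   the position then makes the sequence constant. *)
exists [:: [:: false; true]; [:: true; false]].
apply/seteqP; split=> [_ [b _ <-] w|x x_avoids].
  by rewrite !inE => /orP[]/eqP -> [n] /=; case: b.
exists (x 0%N) => //; apply/funext; elim=> // n ->.
have := x_avoids [:: x n; x n.+1]; rewrite !inE.
case xn: (x n); case xSn: (x n.+1) => //.
all: by case/(_ erefl); exists n; rewrite /= xn xSn.
Qed.

Lemma constant_shift_nonempty : constant_shift !=set0.
Proof. by exists (fun=> true), true. Qed.

Definition constant_sft : sft :=
  Sft constant_shift_finite_type constant_shift_nonempty.

Lemma constant_sft_not_transitive :
  ~ topologically_transitive (sft_sys constant_sft).
Proof.
(* Coordinate 0 determines a constant sequence, so [C false] and [C true] are the two singletons of
   the system. *)
pose C b : set (sft_sys constant_sft) :=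
  set_val @^-1` [set x : sequences bool | x 0%N = b].
have oC b : open (C b).
  exists [set x : sequences bool | x 0%N = b] => //.
  by case: (clopen_coord 0 b).
have C0 b : C b !=set0.
  have cb : constant_sequences (fun=> b) by exists b.
  by exists (SigSub (mem_set cb)).
move=> /(_ _ _ (oC false) (C0 false) (oC true) (C0 true)).
move=> [n [_ [[x xfalse <-]]]]; rewrite /C /=.
(* Coordinate 0 of the iterate is coordinate [n + 0] of [x], so the constant sequence [x] would take
   both values. *)
rewrite [LHS](iter_shift_dyn n 0 x) => xtrue.
have [b _ xb] := set_valP x.
have bfalse : b = false := etrans (congr1 (fun y => y 0%N) xb) xfalse.
have btrue : b = true := etrans (congr1 (fun y => y (n + 0)%N) xb) xtrue.
by rewrite bfalse in btrue.
Qed.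

Theorem proposition10p7 (U : detSysEf) :
  universal_proshift U -> ~ topologically_transitive U.
Proof.
(* A morphism into [U] carries a factor map out of [U], the direction in which transitivity
   passes. *)
move=> [_ univU _] trU; have [g] := univU _ (DS_SFT_sft constant_sft).
exact: constant_sft_not_transitive (factor_transitive (fac g) trU).
Qed.
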